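(* Let $V$ be a vector space over a field $\mathbb{K}$ with dual $V^*=\mathrm{Hom}(V,\mathbb{K})$, and let $\xi\subset V$ and $\eta\subset V^*$ be subspaces of $V$ and $V^*$, respectively. Suppose that $\xi\subset\eta^\bot$ (equivalently, $\eta\subset\xi^\bot$). For any subspace $\alpha\subset V$, the vector space $\alpha_1=\big((\eta^\bot\cap\alpha)+\xi\big)/\xi$ is a subspace of $\eta^\bot/\xi$, and the vector space $\alpha_2=\big((\xi^\bot\cap\alpha^\bot)+\eta\big)/\eta$ is a subspace of $\xi^\bot/\eta$. The subspace $\alpha_2$ is the annihilator of $\alpha_1$ (with $\xi^\bot/\eta$ identified with $(\eta^\bot/\xi)^*$ via the canonical map $\phi$): $$\alpha_2=\alpha_1^\bot .$$
   Context: For $f\in V^*$, $x\in V$ write $\langle f,x\rangle=f(x)$. For a subspace $\zeta\subset V$, its annihilator is $\zeta^\bot=\{f\in V^*\mid \langle f,x\rangle=0\ \text{for all }x\in\zeta\}$; for a subspace $\eta\subset V^*$, its annihilator in $V$ is $\eta^\bot=\{x\in V\mid \langle f,x\rangle=0\ \text{for all } f\in\eta\}$. For $\xi\subset V$ and $\eta\subset\xi^\bot\subset V^*$, the spaces $\xi^\bot/\eta$ and $(\eta^\bot/\xi)^*$ are identified by means of the canonical isomorphism $\phi:\xi^\bot/\eta\to(\eta^\bot/\xi)^*$ given by $\phi(f+\eta)(x+\xi)=\langle f,x\rangle$ for $f\in\xi^\bot$, $x\in\eta^\bot$. Thus $\alpha_1^\bot$ denotes the set of all $f+\eta\in\xi^\bot/\eta$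 such that $\langle f,x\rangle=0$ for all $x+\xi\in\alpha_1$.
   Formalization: The equality of α₂ and α₁^⊥ inside ξ^⊥/η is stated assuming the canonical map φ is bijective, which can fail when V is infinite-dimensional; that φ(α₂) is the annihilator of α₁ in (η^⊥/ξ)^* is stated without this assumption. *)

(* Defs.v *)
From HB Require Import structures.
From mathcomp Require Import all_boot all_algebra generic_quotient ring_quotient.
From mathcomp Require Import boolp.

Set Implicit Arguments.
Unset Strict Implicit.
Unset Printing Implicit Defensive.

Import GRing.Theory.
Local Open Scope ring_scope.
Local Open Scope quotient_scope.

(* A linear subspace of [W] is a [submodClosed W], i.e. a boolean membership
   predicate closed under the linear operations. As [`[< P >] : bool] is the
   classical truth value of [P : Prop], every subspace is of this form. *)

Section Dual.
Variables (K : fieldType) (V : lmodType K).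
Implicit Types (f g h : {scalar V}) (a b : K).

Lemma scalarP f g : f =1 g -> f = g.
Proof.
case: f g => f [[[af bf]] [lf]] [g [[[ag bg]] [lg]]] /= fg.
have {}fg : f = g by exact/funext.
subst g; congr (GRing.Linear.Pack (GRing.Linear.Class _ _)).
  by congr Algebra.isNmodMorphism.Axioms_; exact: Prop_irrelevance.
by congr GRing.isScalable.Axioms_; exact: Prop_irrelevance.
Qed.

Fact scale_scalar_subproof a f : scalar (fun x => a * f x).
Proof. by move=> b x y; rewrite linearP mulrDr /= mulrCA. Qed.

Definition scale_scalar a f : {scalar V} :=
  HB.pack (fun x => a * f x)
    (GRing.isLinear.Build K V K *%R _ (scale_scalar_subproof a f)).

Definition dual : Type := {scalar V}.

HB.instance Definition _ := gen_eqMixin dual.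
HB.instance Definition _ := gen_choiceMixin dual.

Fact dual_addA : associative (fun f g : dual => f \+ g : dual).
Proof. by move=> f g h; apply/scalarP => x /=; rewrite addrA. Qed.
Fact dual_addC : commutative (fun f g : dual => f \+ g : dual).
Proof. by move=> f g; apply/scalarP => x /=; rewrite addrC. Qed.
Fact dual_add0 : left_id (\0 : dual) (fun f g : dual => f \+ g : dual).
Proof. by move=> f; apply/scalarP => x /=; rewrite add0r. Qed.
Fact dual_addN :
  left_inverse (\0 : dual) (fun f => \- f : dual) (fun f g : dual => f \+ g : dual).
Proof. by move=> f; apply/scalarP => x /=; rewrite addNr. Qed.
HB.instance Definition _ :=
  GRing.isZmodule.Build dual dual_addA dual_addC dual_add0 dual_addN.

Fact dual_scaleA a b (f : dual) :
  scale_scalar a (scale_scalar b f) = scale_scalar (a * b) f.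
Proof. by apply/scalarP => x /=; rewrite mulrA. Qed.
Fact dual_scale1 (f : dual) : scale_scalar 1 f = f.
Proof. by apply/scalarP => x /=; rewrite mul1r. Qed.
Fact dual_scaleDr a (f g : dual) :
  scale_scalar a (f + g) = (scale_scalar a f : dual) + (scale_scalar a g : dual).
Proof. by apply/scalarP => x /=; rewrite mulrDr. Qed.
Fact dual_scaleDl (f : dual) a b :
  scale_scalar (a + b) f = (scale_scalar a f : dual) + (scale_scalar b f : dual).
Proof. by apply/scalarP => x /=; rewrite mulrDl. Qed.
HB.instance Definition _ := GRing.Zmodule_isLmodule.Build K dual
  dual_scaleA dual_scale1 dual_scaleDr dual_scaleDl.

Definition pairing (f : dual) (x : V) : K := (f : {scalar V}) x.

End Dual.

Notation "⟨ f , x ⟩" := (pairing f x) (format "⟨ f ,  x ⟩") : ring_scope.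

Section Pairing.
Variables (K : fieldType) (V : lmodType K).
Implicit Types (f g : dual V) (x y : V) (a : K).

Lemma dualP f g : (forall x, ⟨f, x⟩ = ⟨g, x⟩) -> f = g.
Proof. exact: scalarP. Qed.
Lemma pairing0l x : ⟨0, x⟩ = 0. Proof. by []. Qed.
Lemma pairingDl f g x : ⟨f + g, x⟩ = ⟨f, x⟩ + ⟨g, x⟩. Proof. by []. Qed.
Lemma pairingNl f x : ⟨- f, x⟩ = - ⟨f, x⟩. Proof. by []. Qed.
Lemma pairingZl a f x : ⟨a *: f, x⟩ = a * ⟨f, x⟩. Proof. by []. Qed.
Lemma pairing0r f : ⟨f, 0⟩ = 0. Proof. exact: (linear0 (f : {scalar V})). Qed.
Lemma pairingDr f x y : ⟨f, x + y⟩ = ⟨f, x⟩ + ⟨f, y⟩.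
Proof. exact: (linearD (f : {scalar V})). Qed.
Lemma pairingNr f x : ⟨f, - x⟩ = - ⟨f, x⟩.
Proof. exact: (linearN (f : {scalar V})). Qed.
Lemma pairingZr f a x : ⟨f, a *: x⟩ = a * ⟨f, x⟩.
Proof. exact: (scalarZ (f : {scalar V})). Qed.

End Pairing.

Section Annihilators.
Variables (K : fieldType) (V : lmodType K).

(* S^⊥ inside the dual of V, for a subset S of V. *)
Definition annih (S : {pred V}) : {pred dual V} :=
  fun f => `[< forall x, x \in S -> ⟨f, x⟩ = 0 >].

(* T^⊥ inside V itself (not inside the bidual), for a subset T of the dual. *)
Definition preannih (T : {pred dual V}) : {pred V} :=
  fun x => `[< forall f, f \in T -> ⟨f, x⟩ = 0 >].

Lemma annihP (S : {pred V}) f :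
  reflect (forall x, x \in S -> ⟨f, x⟩ = 0) (f \in annih S).
Proof. exact: asboolP. Qed.

Lemma preannihP (T : {pred dual V}) x :
  reflect (forall f, f \in T -> ⟨f, x⟩ = 0) (x \in preannih T).
Proof. exact: asboolP. Qed.

Fact annih_submod S : subsemimod_closed (annih S).
Proof.
apply: GRing.submod_closed_semi; split=> [|a f g /annihP fS /annihP gS].
  by apply/annihP.
apply/annihP => x xS.
by rewrite pairingDl pairingZl fS // gS // mulr0 addr0.
Qed.
HB.instance Definition _ S :=
  GRing.isSubmodClosed.Build K (dual V) (annih S) (annih_submod S).

Fact preannih_submod T : subsemimod_closed (preannih T).
Proof.
apply: GRing.submod_closed_semi; split=> [|a x y /preannihP xT /preannihP yT].
  by apply/preannihP => f _; exact: pairing0r.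
apply/preannihP => f fT.
by rewrite pairingDr pairingZr xT // yT // mulr0 addr0.
Qed.
HB.instance Definition _ T :=
  GRing.isSubmodClosed.Build K V (preannih T) (preannih_submod T).

End Annihilators.

Section Subquotient.
Variables (K : fieldType) (W : lmodType K).

Definition addspace (S T : {pred W}) : {pred W} :=
  fun z => `[< exists x y, [/\ x \in S, y \in T & z = x + y] >].

Record subspace (A : submodClosed W) : Type :=
  Subspace { subspace_val : W; _ : subspace_val \in A }.

HB.instance Definition _ (A : submodClosed W) :=
  [isSub of subspace A for @subspace_val A].
HB.instance Definition _ (A : submodClosed W) := [Choice of subspace A by <:].
HB.instance Definition _ (A : submodClosed W) :=
  [SubChoice_isSubLmodule of subspace A by <:].

Variables A B : submodClosed W.

Definition restr : {pred subspace A} := fun x => val x \in B.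

Lemma restrE x : (x \in restr) = (val x \in B). Proof. by []. Qed.

Fact restr_submod : subsemimod_closed restr.
Proof.
apply: GRing.submod_closed_semi; split=> [|a x y]; rewrite !restrE.
  by rewrite linear0 rpred0.
by move=> xB yB; rewrite linearP rpredD // rpredZ.
Qed.
HB.instance Definition _ :=
  GRing.isSubmodClosed.Build K (subspace A) restr restr_submod.

(* The quotient space [A / B]; it is only meant to be used when [B] is
   contained in [A] (otherwise it is [A / (A :&: B)]). *)
Definition subquot : Type := Quotient.quot restr.

HB.instance Definition _ := ZmodQuotient.on subquot.

Definition proj (x : subspace A) : subquot := \pi_subquot x.

Lemma projE x y : (proj x = proj y) <-> (val x - val y \in B).
Proof.
rewrite /proj -[val x - val y]/(val (x - y)) -[_ \in B]/((x - y) \in restr).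
by rewrite Quotient.idealrBE; split=> /eqP.
Qed.

Lemma projK (X : subquot) : proj (repr X) = X. Proof. exact: reprK. Qed.

Lemma proj_eq x y : val x - val y \in B -> proj x = proj y.
Proof. by move/projE. Qed.

Definition scale_subquot (a : K) (X : subquot) : subquot := proj (a *: repr X).

Fact scale_subquotE a x : scale_subquot a (proj x) = proj (a *: x).
Proof.
have: repr (proj x) - x \in restr by rewrite restrE linearB; apply/projE/projK.
move=> /(rpredZ a); rewrite scalerBr restrE linearB; exact: proj_eq.
Qed.

Fact scale_subquotA a b X :
  scale_subquot a (scale_subquot b X) = scale_subquot (a * b) X.
Proof. by rewrite -[X]projK !scale_subquotE scalerA. Qed.
Fact scale_subquot1 X : scale_subquot 1 X = X.
Proof. by rewrite -[X]projK !scale_subquotE scale1r. Qed.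
Fact projD x y : proj (x + y) = proj x + proj y.
Proof. by rewrite /proj !piE. Qed.
Fact scale_subquotDr a X Y :
  scale_subquot a (X + Y) = scale_subquot a X + scale_subquot a Y.
Proof.
by rewrite -[X]projK -[Y]projK -projD !scale_subquotE -projD scalerDr.
Qed.
Fact scale_subquotDl X a b :
  scale_subquot (a + b) X = scale_subquot a X + scale_subquot b X.
Proof. by rewrite -[X]projK !scale_subquotE -projD scalerDl. Qed.
HB.instance Definition _ := GRing.Zmodule_isLmodule.Build K subquot
  scale_subquotA scale_subquot1 scale_subquotDr scale_subquotDl.

Fact proj_is_linear : linear proj.
Proof. by move=> a x y; rewrite projD -scale_subquotE. Qed.
HB.instance Definition _ :=
  GRing.isLinear.Build K (subspace A) subquot *:%R proj proj_is_linear.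

(* The subset [C / B] of [A / B]. *)
Definition subquot_of (C : {pred W}) : {pred subquot} :=
  fun X => `[< exists2 x : subspace A, val x \in C & X = proj x >].

End Subquotient.

Arguments proj {K W A B} x.
Arguments subquot_of {K W} A B C.

Section Canonical.
Variables (K : fieldType) (V : lmodType K).
Variables (xi : submodClosed V) (eta : submodClosed (dual V)).

Lemma phi_compat (f g : subspace (annih xi)) (x y : subspace (preannih eta)) :
  val f - val g \in eta -> val x - val y \in xi ->
  ⟨val f, val x⟩ = ⟨val g, val y⟩.
Proof.
move=> fgP xyP; apply/eqP; rewrite -subr_eq0.
have -> : ⟨val f, val x⟩ - ⟨val g, val y⟩ =
    ⟨val f - val g, val x⟩ + ⟨val g, val x - val y⟩.
  by rewrite pairingDl pairingNl pairingDr pairingNr addrA subrK.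
have /preannihP -> // := valP x.
by have /annihP -> // := valP g; rewrite addr0.
Qed.

Definition phi_fun (F : subquot (annih xi) eta) (X : subquot (preannih eta) xi) : K :=
  ⟨val (repr F), val (repr X)⟩.

Fact phi_funE f x : phi_fun (proj f) (proj x) = ⟨val f, val x⟩.
Proof. by apply: phi_compat; apply/projE; rewrite projK. Qed.

Fact phi_subproof F : scalar (phi_fun F).
Proof.
move=> a X Y; rewrite -[F]projK -[X]projK -[Y]projK -linearP !phi_funE.
by rewrite linearP pairingDr pairingZr.
Qed.

Definition phi (F : subquot (annih xi) eta) : dual (subquot (preannih eta) xi) :=
  HB.pack_for {scalar (subquot (preannih eta) xi)} (phi_fun F)
    (GRing.isLinear.Build K _ K *%R _ (phi_subproof F)).

Lemma phiE f x : ⟨phi (proj f), proj x⟩ = ⟨val f, val x⟩.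
Proof. exact: phi_funE. Qed.

Fact phi_is_linear : linear phi.
Proof.
move=> a F G; apply: dualP => X; rewrite -[F]projK -[G]projK -[X]projK -linearP.
by rewrite pairingDl pairingZl !phiE linearP pairingDl pairingZl.
Qed.

(* S^⊥ as a subset of xi^⊥ / eta: the cosets f + eta such that f vanishes at
   every x with x + xi in S. It is the preimage under [phi] of [annih S]. *)
Definition quot_annih (S : {pred subquot (preannih eta) xi}) :
    {pred subquot (annih xi) eta} :=
  fun F => `[< exists2 f : subspace (annih xi), F = proj f &
    forall x : subspace (preannih eta), proj x \in S -> ⟨val f, val x⟩ = 0 >].

Variable alpha : submodClosed V.

Definition alpha1 : {pred subquot (preannih eta) xi} :=
  subquot_of (preannih eta) xi
    (addspace [predI preannih eta & alpha] xi).

Definition alpha2 : {pred subquot (annih xi) eta} :=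
  subquot_of (annih xi) eta
    (addspace [predI annih xi & annih alpha] eta).

End Canonical.

Arguments phi {K V} xi eta F.
Arguments alpha1 {K V} xi eta alpha.
Arguments alpha2 {K V} xi eta alpha.
Arguments quot_annih {K V xi eta} S.

(* In infinite dimension [phi xi eta] fails to be injective when eta is smaller
   than its biannihilator; it is bijective when [V] is finite-dimensional. *)
Section FiniteDimension.
Import VectorInternalTheory.
Variables (K : fieldType).

Lemma vspace_of_submod (V : vectType K) (S : {pred V}) :
  submod_closed S -> exists U : {vspace V}, S =i U.
Proof.
case=> S0 Slin.
pose P n := `[< exists2 U : {vspace V}, {subset U <= S} & \dim U = n >].
have exP : exists n, P n.
  exists 0%N; apply/asboolP; exists 0%VS; last exact: dimv0.
  by move=> x; rewrite memv0 => /eqP ->.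
have ubP n : P n -> (n <= \dim {:V})%N.
  by move=> /asboolP [U _ <-]; apply: dimvS; exact: subvf.
case: (ex_maxnP exP ubP) => _ /asboolP [U US <-] maxU.
exists U => x; apply/idP/idP => [xS|/US //].
have US' : {subset (U + <[x]>)%VS <= S}.
  move=> _ /memv_addP [u uU [_ /vlineP [k ->] ->]].
  by rewrite addrC Slin // US.
have le : (\dim (U + <[x]>) <= \dim U)%N.
  by apply: maxU; apply/asboolP; exists (U + <[x]>)%VS.
have /eqP -> : U == (U + <[x]>)%VS by rewrite eqEdim addvSl.
exact/(subvP (addvSr _ _))/memv_line.
Qed.

Variables (V : vectType K) (xi : submodClosed V) (eta : submodClosed (dual V)).

Lemma preannihK f : f \in annih (preannih eta) -> f \in eta.
Proof.
move=> fP.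
pose n := dim V.
pose ev (r : 'rV[K]_n) (x : V) : K := (v2r x *m r^T) 0 0.
have evlin r : scalar (ev r).
  by move=> a x y; rewrite /ev linearP mulmxDl -scalemxAl !mxE.
pose ofrow (r : 'rV[K]_n) : dual V := HB.pack_for {scalar V} (ev r)
  (GRing.isLinear.Build K V K *%R _ (evlin r)).
have ofrowE r x : ⟨ofrow r, x⟩ = (v2r x *m r^T) 0 0 by [].
pose rw (h : dual V) : 'rV[K]_n := \row_i ⟨h, r2v (delta_mx 0 i)⟩.
have rwK h : ofrow (rw h) = h.
  apply: dualP => x; rewrite ofrowE -[in RHS](v2rK x) [v2r x in RHS]row_sum_delta.
  rewrite linear_sum [RHS](linear_sum (h : {scalar V})) mxE.
  by apply: eq_bigr => i _; rewrite !mxE linearZ; exact/esym/pairingZr.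
pose S : {pred 'rV[K]_n} := fun r => ofrow r \in eta.
have SE r : (r \in S) = (ofrow r \in eta) by [].
have ofrowP a r s : ofrow (a *: r + s) = a *: ofrow r + ofrow s.
  apply: dualP => x; rewrite pairingDl pairingZl !ofrowE.
  by rewrite linearP mulmxDr -scalemxAr !mxE.
have ofrow0 : ofrow 0 = 0.
  by apply: dualP => x; rewrite ofrowE trmx0 mulmx0 mxE.
have [|U SU] := @vspace_of_submod _ S.
  split; first by rewrite SE ofrow0 rpred0.
  by move=> a r s; rewrite !SE ofrowP => rS sS; rewrite rpredD // rpredZ.
pose E := \matrix_(i < \dim U) (vbasis U)`_i.
have [/submxP [D rD]|] := boolP (rw f <= E)%MS.
  rewrite -[f]rwK -SE SU rD mulmx_sum_row; apply: memv_suml => i _.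
  by rewrite rowK memvZ // vbasis_mem // mem_nth // size_tuple.
rewrite submxE => /eqP nz; exfalso; apply: nz.
apply/rowP => j; rewrite [RHS]mxE.
have [x xE] : exists x : V, v2r x = (col j (cokermx E))^T.
  by eexists; exact: r2vK.
have hx h : ⟨h, x⟩ = (rw h *m cokermx E) 0 j.
  rewrite -{1}[h]rwK ofrowE xE -trmx_mul !mxE.
  by apply: eq_bigr => i _; rewrite !mxE.
rewrite -hx; move/annihP: fP; apply.
apply/preannihP => h hE; rewrite hx.
have : rw h \in U by rewrite -SU SE rwK.
move=> /coord_vbasis ->; rewrite mulmx_suml summxE big1 // => i _.
rewrite -scalemxAl mxE.
have -> : (vbasis U)`_i = row i E by rewrite rowK.
by rewrite -row_mul mulmx_coker !mxE mulr0.
Qed.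

Lemma phi_bij : {subset xi <= preannih eta} -> bijective (phi xi eta).
Proof.
move=> xi_eta.
have inj : injective (phi xi eta).
  move=> F G; rewrite -[F]projK -[G]projK => FG; apply: proj_eq.
  apply: preannihK; apply/annihP => x xP.
  rewrite pairingDl pairingNl; apply/eqP; rewrite subr_eq0.
  by rewrite -[x]/(val (Subspace xP)) -!phiE FG.
have surj g : exists F, phi xi eta F = g.
  have [|U PU] := @vspace_of_submod V (preannih eta).
    exact: submodClosedP.
  have memP x : projv U x \in preannih eta by rewrite PU memv_proj.
  pose ext x : K := ⟨g, proj (Subspace (memP x))⟩.
  have extlin : scalar ext.
    move=> a x y; rewrite /ext -pairingZr -pairingDr -linearP.
    by congr (⟨g, proj _⟩); apply: val_inj; rewrite /= linearP.
  pose f : dual V := HB.pack_for {scalar V} ext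
    (GRing.isLinear.Build K V K *%R _ extlin).
  have extE (x : subspace (preannih eta)) : ⟨f, val x⟩ = ⟨g, proj x⟩.
    rewrite [LHS]/pairing /= /ext; congr (⟨g, proj _⟩); apply: val_inj => /=.
    by rewrite projv_id // -PU (valP x).
  have fP : f \in annih xi.
    apply/annihP => x xxi.
    rewrite -[x]/(val (Subspace (xi_eta x xxi))) extE.
    rewrite (_ : proj _ = 0) ?pairing0r // -(linear0 proj); apply: proj_eq.
    by rewrite -[X in _ - X]/(0 : V) subr0.
  exists (proj (Subspace fP)); apply: dualP => X.
  by rewrite -[X]projK phiE extE.
pose psi g := projT1 (cid (surj g)).
have phiK g : phi xi eta (psi g) = g by rewrite /psi; case: cid.
by exists psi => // F; apply: inj; rewrite phiK.
Qed.

End FiniteDimension.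

(* Main.v *)
(** The substantial point is that every linear form g on eta^bot / xi vanishing
    on alpha_1 comes from some f in xi^bot /\ alpha^bot. The pullback of g to
    eta^bot vanishes on eta^bot /\ alpha, so it extends to a form on V
    vanishing on alpha; this extension vanishes on xi because xi is contained
    in eta^bot and is killed by the projection. *)

Require Import Defs.
From HB Require Import structures.
From mathcomp Require Import all_boot all_algebra.
From mathcomp Require Import boolp classical_sets.

Set Implicit Arguments.
Unset Strict Implicit.
Unset Printing Implicit Defensive.

Import GRing.Theory.
Local Open Scope ring_scope.

Section Extension.
Variables (K : fieldType) (V : lmodType K).

(* The subspace [C] produced here plays the role of the kernel of an extension
   of [l]: the extension sends [v] to [l x] for any [x] with [v - x] in [C].
   It is a maximal subspace containing [B] on which [l] vanishes. *)
Lemma exists_large_kernel (A B : submodClosed V) (l : {scalar subspace A}) :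
    (forall x, val x \in B -> l x = 0) ->
  exists C : set V,
    [/\ forall a x y, C x -> C y -> C (a *: x + y),
        forall x, x \in B -> C x,
        forall x, C (val x) -> l x = 0 &
        forall v, exists x : subspace A, C (v - val x)].
Proof.
move=> lB.
(* The empty set must be admissible, as the union of the empty chain. *)
pose P (C : set V) := [/\ forall a x y, C x -> C y -> C (a *: x + y),
  forall z, C z -> forall x, x \in B -> C x & forall x, C (val x) -> l x = 0].
have [F FP Ftot|C [[Clin CB Cl] Cmax]] := @Zorn_bigcup _ P.
  split=> [a x y [X FX Xx] [Y FY Yy]|z [X FX Xz] x xB|x [X FX Xx]].
  - have [XY|YX] := Ftot _ _ FX FY.
    + by exists Y => //; have [Ylin _ _] := FP _ FY; apply: Ylin => //; apply: XY.
    + by exists X => //; have [Xlin _ _] := FP _ FX; apply: Xlin => //; apply: YX.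
  - by exists X => //; have [_ XB _] := FP _ FX; apply: (XB z).
  - by have [_ _ Xl] := FP _ FX; apply: Xl.
(* If [C] misses 0 it is empty, as a nonempty admissible set contains [B]; then [B] itself is
   admissible and strictly larger. *)
have C0 : C 0.
  apply: contrapT => nC0.
  have Ce z : ~ C z by move=> Cz; apply/nC0/(CB z)/rpred0.
  apply: (Cmax [set x | x \in B]%classic).
    by split=> [z /Ce //|BC]; apply/nC0/BC/rpred0.
  by split=> //= a x y xB yB; rewrite rpredD // rpredZ.
exists C; split=> // [x|v]; first exact: CB C0 x.
apply: contrapT => nv.
(* If v lies outside A + C, then A meets C + K v only inside C: a nonzero coefficient k would give v
   - k^-1 x = - k^-1 c in C. *)
have nvA c k (x : subspace A) : C c -> val x = c + k *: v -> k = 0.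
  move=> Cc xE; apply: contrapT => /eqP k0; apply: nv; exists (k^-1 *: x).
  have -> : v - val (k^-1 *: x) = (- k^-1) *: c + 0.
    rewrite linearZ /= xE scalerN scalerDr scalerA mulVf // scale1r addr0 scaleNr.
    by rewrite opprD addrCA subrr addr0.
  exact: Clin.
(* By [nvA], adjoining v to [C] adds no element of A, so C + K v is an admissible set strictly
   containing [C]. *)
apply: (Cmax [set z | exists2 c, C c & exists k, z = c + k *: v]%classic).
  split=> [c Cc|DC]; first by exists c => //; exists 0; rewrite scale0r addr0.
  apply: nv; exists 0; rewrite [val _]linear0 subr0; apply: DC.
  by exists 0 => //; exists 1; rewrite scale1r add0r.
split=> [a _ _ [c Cc [k ->]] [d Cd [m ->]]|_ _ x xB|x [c Cc [k xE]]].
- exists (a *: c + d); first exact: Clin.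
  by exists (a * k + m); rewrite scalerDr scalerDl scalerA addrACA.
- by exists x; [exact: CB C0 x xB | exists 0; rewrite scale0r addr0].
- by apply: Cl; rewrite xE (nvA _ _ _ Cc xE) scale0r addr0.
Qed.

(** With [p v] a chosen element of A congruent to v modulo C, the extension is v |-> l (p v). The
    choice is immaterial because l vanishes on the intersection of A and C; the form kills B because
    B lies in C, so 0 may replace [p x] for x in B. *)
Lemma extend_scalar (A B : submodClosed V) (l : {scalar subspace A}) :
    (forall x, val x \in B -> l x = 0) ->
  exists2 f : dual V, f \in annih B & forall x, ⟨f, val x⟩ = l x.
Proof.
move=> /exists_large_kernel [C [Clin CB Cl /choice [p pP]]].
have C0 : C 0 by apply/CB/rpred0.
have lE v x : C (v - val x) -> l (p v) = l x.
  move=> Cx; apply/eqP; rewrite -subr_eq0 -linearB; apply/eqP/Cl.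
  have -> : val (p v - x) = -1 *: (v - val (p v)) + (v - val x).
    by rewrite linearB scaleN1r opprB addrA subrK.
  exact: Clin.
have lin : scalar (fun v => l (p v)).
  (* The element a p(u) + p(v) is congruent to a u + v modulo C. *)
  move=> a u v; rewrite -linearP; apply: lE.
  by rewrite [val _]linearP opprD addrACA -scalerBr; apply: Clin.
exists (HB.pack_for {scalar V} (fun v => l (p v))
  (GRing.isLinear.Build K V K *%R _ lin)).
  apply/annihP => x xB; rewrite -[RHS](linear0 l); apply: lE.
  by rewrite [val _]linear0 subr0; apply: CB.
by move=> x; apply: lE; rewrite subrr.
Qed.

End Extension.

Section Subspaces.
Variables (K : fieldType) (W : lmodType K).

Lemma addspaceP (S T : {pred W}) z :
  reflect (exists x y, [/\ x \in S, y \in T & z = x + y]) (z \in addspace S T).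
Proof. exact: asboolP. Qed.

Lemma addspace_submod_closed (S T : {pred W}) :
  submod_closed S -> submod_closed T -> submod_closed (addspace S T).
Proof.
move=> [S0 Slin] [T0 Tlin]; split.
  by apply/addspaceP; exists 0, 0; rewrite addr0.
move=> a _ _ /addspaceP[x [y [xS yT ->]]] /addspaceP[z [t [zS tT ->]]].
apply/addspaceP; exists (a *: x + z), (a *: y + t).
by split; [exact: Slin | exact: Tlin | rewrite scalerDr addrACA].
Qed.

Lemma predI_submod_closed (S T : submodClosed W) :
  submod_closed [predI S & T].
Proof.
split=> [|a x y]; rewrite !inE ?rpred0 //.
by move=> /andP[xS xT] /andP[yS yT]; rewrite !rpredD ?rpredZ.
Qed.

Lemma subquot_ofP (A B : submodClosed W) (C : {pred W}) (X : subquot A B) :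
  reflect (exists2 x : subspace A, val x \in C & X = proj x)
          (X \in subquot_of A B C).
Proof. exact: asboolP. Qed.

Lemma subquot_of_submod_closed (A B : submodClosed W) (C : {pred W}) :
  submod_closed C -> submod_closed (subquot_of A B C).
Proof.
move=> [C0 Clin]; split.
  by apply/subquot_ofP; exists 0; rewrite linear0.
move=> a _ _ /subquot_ofP[x xC ->] /subquot_ofP[y yC ->].
by apply/subquot_ofP; exists (a *: x + y); rewrite linearP //; exact: Clin.
Qed.

End Subspaces.

Section Canonical.
Variables (K : fieldType) (V : lmodType K).
Variables (xi alpha : submodClosed V) (eta : submodClosed (dual V)).

Lemma sub_preannih_annih (S : {pred V}) (T : {pred dual V}) :
  {subset S <= preannih T} <-> {subset T <= annih S}.
Proof.
split=> sub.
  by move=> f fT; apply/annihP => x /sub /preannihP; apply.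
by move=> x xS; apply/preannihP => f /sub /annihP; apply.
Qed.

(** The pairing of two cosets does not depend on representatives, so [repr F] can serve as the form
    required by [quot_annih]. *)
Lemma phi_annih_quot_annih (S : {pred subquot (preannih eta) xi}) F :
  (phi xi eta F \in annih S) = (F \in quot_annih S).
Proof.
apply/annihP/asboolP => [FS|[f -> fS] X].
  exists (repr F); rewrite ?projK // => x xS.
  by rewrite -phiE projK; exact: FS.
by rewrite -[X]projK phiE; exact: fS.
Qed.

Lemma phi_alpha2_annih F :
  F \in alpha2 xi eta alpha -> phi xi eta F \in annih (alpha1 xi eta alpha).
Proof.
move=> /subquot_ofP[f /addspaceP[f1 [f2 [/andP[f1xi f1al] f2eta fE]]] ->].
apply/annihP => X.
move=> /subquot_ofP[x /addspaceP[x1 [x2 [/andP[x1et x1al] x2xi xE]]] ->].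
(* All terms vanish: f2 in eta kills x, which lies in eta^bot, while f1 kills x1 in alpha and x2 in
   xi. *)
have /preannihP f2x := valP x.
rewrite phiE fE pairingDl (f2x f2) // xE pairingDr.
by rewrite (annihP _ _ f1al) // (annihP _ _ f1xi) // !addr0.
Qed.

Lemma annih_alpha1_phi (g : dual (subquot (preannih eta) xi)) :
    {subset xi <= preannih eta} -> g \in annih (alpha1 xi eta alpha) ->
  exists2 F, F \in alpha2 xi eta alpha & phi xi eta F = g.
Proof.
move=> xi_eta /annihP gal.
pose g' (x : subspace (preannih eta)) := ⟨g, proj x⟩.
have lin : scalar g'.
  by move=> a x y; rewrite /g' linearP pairingDr pairingZr.
pose l : {scalar subspace (preannih eta)} :=
  HB.pack_for {scalar subspace (preannih eta)} g'
    (GRing.isLinear.Build K _ K *%R _ lin).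
(* Elements of eta^bot that lie in alpha project into alpha_1, where g vanishes. *)
have [|f fal fE] := @extend_scalar _ _ _ alpha l.
  move=> x xal; apply: gal; apply/subquot_ofP; exists x => //.
  apply/addspaceP; exists (val x), 0.
  by rewrite rpred0 addr0 inE /= xal (valP x).
have fxi : f \in annih xi.
  apply/annihP => x xxi; rewrite -[x]/(val (Subspace (xi_eta x xxi))) fE.
  rewrite -[LHS]/⟨g, proj _⟩ (_ : proj _ = 0) ?pairing0r // -(linear0 proj).
  by apply: proj_eq; rewrite [val 0]linear0 subr0.
exists (proj (Subspace fxi)).
  apply/subquot_ofP; exists (Subspace fxi) => //.
  by apply/addspaceP; exists f, 0; rewrite rpred0 addr0 inE /= fxi fal.
by apply: dualP => X; rewrite -[X]projK phiE fE.
Qed.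

End Canonical.

Theorem proposition2p1 (K : fieldType) (V : lmodType K)
    (xi : submodClosed V) (eta : submodClosed (dual V)) :
  ({subset xi <= preannih eta} <-> {subset eta <= annih xi}) /\
  ({subset xi <= preannih eta} ->
   forall alpha : submodClosed V,
   [/\ submod_closed (alpha1 xi eta alpha),
       submod_closed (alpha2 xi eta alpha),
       forall g : dual (subquot (preannih eta) xi),
         g \in annih (alpha1 xi eta alpha) <->
         exists2 F, F \in alpha2 xi eta alpha & phi xi eta F = g &
       bijective (phi xi eta) ->
         alpha2 xi eta alpha =i quot_annih (alpha1 xi eta alpha)]).
Proof.
split=> [|xi_eta alpha]; first exact: sub_preannih_annih.
have annihE g : g \in annih (alpha1 xi eta alpha) <->
    exists2 F, F \in alpha2 xi eta alpha & phi xi eta F = g.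
  split=> [|[F Fal <-]]; first exact: annih_alpha1_phi.
  exact: phi_alpha2_annih.
split=> //.
- apply/subquot_of_submod_closed/addspace_submod_closed.
    exact: predI_submod_closed.
  exact: submodClosedP.
- apply/subquot_of_submod_closed/addspace_submod_closed.
    exact: predI_submod_closed.
  exact: submodClosedP.
(* If phi F annihilates alpha_1, then phi F = phi G for some G in alpha_2, and injectivity gives F =
   G. *)
- move=> /bij_inj phi_inj F; rewrite -phi_annih_quot_annih.
  apply/idP/idP => [|/annihE[G Gal /phi_inj <-] //].
  exact: phi_alpha2_annih.
Qed.
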